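(* Fix an iteration $i$, a stage $t\in\{2,\ldots,T\}$, a sampled path $k$, an uncertainty realization $\omega_t^j$ ($1\le j\le N_t$), and a binary incumbent state $x_{t-1}^{ik}\in\{0,1\}^{h_{t-1}}$. Let $L(\psi_t^{i+1},\omega_t^j)\in\mathbb{R}$ be a lower bound on $\underline{Q}_t^i(\cdot,\psi_t^{i+1},\omega_t^j)$, that is, $\underline{Q}_t^i(x,\psi_t^{i+1},\omega_t^j)\ge L(\psi_t^{i+1},\omega_t^j)$ for all $x\in\{0,1\}^{h_{t-1}}$. Let $S(x_{t-1}^{ik})=\{r : x_{t-1,r}^{ik}=1\}$ and define $\pi_t^{ij}\in\mathbb{R}^{h_{t-1}}$ componentwise by $$\pi_{t,r}^{ij}=\begin{cases}\underline{Q}_t^i(x_{t-1}^{ik},\psi_t^{i+1},\omega_t^j)-L(\psi_t^{i+1},\omega_t^j), & r\in S(x_{t-1}^{ik}),\\ L(\psi_t^{i+1},\omega_t^j)-\underline{Q}_t^i(x_{t-1}^{ik},\psi_t^{i+1},\omega_t^j), & r\notin S(x_{t-1}^{ik}).\end{cases}$$ Then $\pi_t^{ij}$ is an optimal solution of the Lagrangian dual problem $$\max_{\pi\in\mathbb{R}^{h_{t-1}}}\left(\mathcal{L}_t^i(\pi;\omega_t^j)+\pi^\top x_{t-1}^{ik}\right).$$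
   Context: Setting: a $T$-stage stochastic mixed-integer program with stage-wise independent uncertainty. At stage $t$ there are $N_t$ realizations $\omega_t^1,\ldots,\omega_t^{N_t}$. The state vector at stage $t$ is $x_t$, of dimension $h_t$, and is binary; $y_t$ is the vector of local variables. The data $\omega_t^j$ determine a real-valued objective function $f_t(x_t,y_t,\omega_t^j)$ and a constraint set $X_t$ (which may depend on $\omega_t^j$) of triples $(z_t,x_t,y_t)$, where $z_t$ is a copy of the previous stage's state; $X_t$ includes any integrality restrictions on $x_t,y_t$. The function $\psi_t^{i+1}:\mathbb{R}^{h_t}\to\mathbb{R}$ is the current approximation of the expected cost-to-go, a pointwise maximum of finitely many affine functions. $v_r$ denotes the $r$-th component of a vector $v$. For $x\in\{0,1\}^{h_{t-1}}$ the approximate value function is $$\underline{Q}_t^i(x,\psi_t^{i+1},\omega_t^j)=\min_{x_t,y_t,z_t}\left\{f_t(x_t,y_t,\omega_t^j)+\psi_t^{i+1}(x_t) : z_t=x,\ z_t\in\{0,1\}^{h_{t-1}},\ (z_t,x_t,y_t)\in X_t\right\}.$$ For $\pi\in\mathbb{R}^{h_{t-1}}$ the Lagrangian function, obtained by relaxing $z_t=x$, is $$\mathcal{L}_t^i(\pi;\omega_t^j)=\min_{x_t,y_t,z_t}\left\{f_t(x_t,y_t,\omega_t^j)+\psi_t^{i+1}(x_t)-\pi^\top z_t : z_t\in\{0,1\}^{h_{t-1}},\ (z_t,x_t,y_t)\in X_t\right\}.$$ Standing assumptions: relatively complete recourse (for every $x\in\{0,1\}^{h_{t-1}}$ the problem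 defining $\underline{Q}_t^i(x,\psi_t^{i+1},\omega_t^j)$ is feasible), and the minimum defining $\underline{Q}_t^i(x,\psi_t^{i+1},\omega_t^j)$ is finite and attained for every such $x$. *)

(* Defs.v *)
From mathcomp Require Import all_boot all_order all_algebra.
From mathcomp Require Import all_classical all_reals all_analysis.

Set Implicit Arguments.
Unset Strict Implicit.
Unset Printing Implicit Defensive.

Import Order.TTheory GRing.Theory Num.Theory.

Local Open Scope classical_set_scope.
Local Open Scope ring_scope.

Definition binary (R : realType) (n : nat) (x : 'cV[R]_n) : Prop :=
  forall r, x r 0 = 0 \/ x r 0 = 1.

Definition dot (R : realType) (n : nat) (u v : 'cV[R]_n) : R :=
  \sum_r u r 0 * v r 0.

Definition affine_fun (R : realType) (n : nat) (c : 'cV[R]_n * R)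
  (x : 'cV[R]_n) : R := dot c.1 x + c.2.

(* The maximum is taken over the nonempty family c0 :: cs. *)
Definition max_affine (R : realType) (n : nat) (g : 'cV[R]_n -> R) : Prop :=
  exists (c0 : 'cV[R]_n * R) (cs : seq ('cV[R]_n * R)),
    forall x, g x = \big[Num.max/affine_fun c0 x]_(c <- cs) affine_fun c x.

(* Stages are numbered from 1 to [horizon]; the families are indexed by all of
   nat, and only their values at actual stages matter.  An element (z, x, y) of
   [constr t w] consists of the copy z of the state of stage t - 1, the state x
   of stage t and the local variables y of stage t.  Any integrality
   restriction on y is part of [constr]. *)
Record program (R : realType) := Program {
  horizon : nat;
  nreal : nat -> nat;
  sdim : nat -> nat;
  ldim : nat -> nat;
  data : nat -> Type;
  omega : forall t, 'I_(nreal t) -> data t;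
  cost : forall t, 'cV[R]_(sdim t) -> 'cV[R]_(ldim t) -> data t -> R;
  constr : forall t, data t ->
    set ('cV[R]_(sdim t.-1) * 'cV[R]_(sdim t) * 'cV[R]_(ldim t));
  constr_binary : forall t (w : data t) z x y,
    constr w (z, x, y) -> binary x
}.

(* The value of a minimization problem is taken in the extended reals: +oo when
   it is infeasible and -oo when it is unbounded. *)
Definition min_value (R : realType) (A : Type) (D : set A) (g : A -> R)
  : \bar R := ereal_inf [set (g p)%:E | p in D].

(* Since g is real-valued, an attained minimum is finite. *)
Definition min_attained (R : realType) (A : Type) (D : set A) (g : A -> R)
  : Prop := exists2 p, D p & (g p)%:E = min_value D g.

Definition optimal_max (R : realType) (A : Type) (g : A -> \bar R) (a : A)
  : Prop := g a \is a fin_num /\ forall b, (g b <= g a)%E.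

Section StageProblem.
Context (R : realType) (P : program R) (t : nat).
Context (psi : 'cV[R]_(sdim P t) -> R) (w : data P t).

Definition triple : Type :=
  ('cV[R]_(sdim P t.-1) * 'cV[R]_(sdim P t) * 'cV[R]_(ldim P t))%type.

Definition relaxed_feasible : set triple :=
  [set p | binary p.1.1 /\ constr w p].

Definition feasible (x : 'cV[R]_(sdim P t.-1)) : set triple :=
  [set p | p.1.1 = x /\ relaxed_feasible p].

Definition objective (p : triple) : R := cost p.1.2 p.2 w + psi p.1.2.

Definition Qval (x : 'cV[R]_(sdim P t.-1)) : \bar R :=
  min_value (feasible x) objective.

Definition Lagrangian (pi : 'cV[R]_(sdim P t.-1)) : \bar R :=
  min_value relaxed_feasible (fun p => objective p - dot pi p.1.1).

Definition dual_objective (x pi : 'cV[R]_(sdim P t.-1)) : \bar R :=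
  (Lagrangian pi + (dot pi x)%:E)%E.

End StageProblem.

Definition support1 (R : realType) (n : nat) (x : 'cV[R]_n) : {set 'I_n} :=
  [set r | x r 0 == 1]%SET.

Definition cut_coef (R : realType) (n : nat) (x : 'cV[R]_n) (q L : R)
  : 'cV[R]_n := \col_r (if r \in support1 x then q - L else L - q).

Section Attainment.
Context (R : realType) (P : program R) (t : nat).
Context (psi : 'cV[R]_(sdim P t) -> R) (w : data P t).

(* There are finitely many binary copies z, so the relaxed problems inherit
   attainment from the problems defining Qval: [Lagrangian] is a genuine
   minimum. *)
Lemma Lagrangian_attained (pi : 'cV[R]_(sdim P t.-1)) :
  (forall x, binary x -> min_attained (feasible w x) (objective psi w)) ->
  min_attained (relaxed_feasible w)
    (fun p => objective psi w p - dot pi p.1.1).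
Proof.
move=> att.
pose vec (b : {ffun 'I_(sdim P t.-1) -> bool}) : 'cV[R]_(sdim P t.-1) :=
  \col_r (b r)%:R.
have vecb b : binary (vec b).
  by move=> r; rewrite mxE; case: (b r); [right|left].
have /choice [m mP] : forall b, exists p,
    feasible w (vec b) p /\
    forall q, feasible w (vec b) q -> objective psi w p <= objective psi w q.
  move=> b; have [p Dp pE] := att _ (vecb b); exists p; split=> // q Dq.
  by rewrite -lee_fin pE; apply: ereal_inf_lbound; exists q.
pose g b := objective psi w (m b) - dot pi (m b).1.1.
pose b0 : {ffun 'I_(sdim P t.-1) -> bool} := [ffun=> false].
case: (Order.TotalTheory.arg_minP g (isT : xpredT b0)) => b _ bmin.
have [[_ Db] _] := mP b; exists (m b) => //; apply/le_anti/andP; split; last first.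
  by apply: ereal_inf_lbound; exists (m b).
apply: le_ereal_inf_tmp => _ [q Dq <-]; rewrite lee_fin.
pose c : {ffun 'I_(sdim P t.-1) -> bool} := [ffun r => q.1.1 r 0 == 1].
have qc : q.1.1 = vec c.
  apply/matrixP => r s; rewrite ord1 mxE ffunE.
  by case: (Dq.1 r) => ->; rewrite ?eqxx // eq_sym oner_eq0.
have [[zc _] cmin] := mP c.
apply: le_trans (bmin c isT) _.
by rewrite /g zc -qc lerD2r; apply: cmin.
Qed.

End Attainment.

(* Main.v *)
Require Import Defs.
From mathcomp Require Import all_boot all_order all_algebra.
From mathcomp Require Import all_classical all_reals all_analysis.

Import Order.TTheory GRing.Theory Num.Theory.

Local Open Scope classical_set_scope.
Local Open Scope ring_scope.

(** Relaxing [z = x] can only lower the minimum, so every multiplier gives a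
    dual value at most [q], the value of the stage problem at the incumbent
    ([dual_objective_le_Qval]).  It therefore suffices that the given multiplier
    reaches [q].  Its components all have size [q - L], with signs such that
    moving the copy [z] away from the binary incumbent costs exactly [q - L] per
    flipped coordinate ([dot_cut_coef_sub]).  If nothing is flipped, the
    triple is feasible at the incumbent and costs at least [q].  If some
    coordinate is flipped, the triple costs at least [L], and the penalty of at
    least [q - L] again brings the total up to [q] ([cut_coef_tight]). *)

Lemma Qval_le_objective {R : realType} {P : program R} {t : nat}
    (psi : 'cV[R]_(sdim P t) -> R) {w : data P t} {p : triple P t} :
  relaxed_feasible w p -> (Qval psi w p.1.1 <= (objective psi w p)%:E)%E.
Proof. by move=> Dp; apply: ereal_inf_lbound; exists p. Qed.

(** Weak duality: the penalty [dot pi x - dot pi z] vanishes on the triples that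
    satisfy [z = x]. *)
Lemma dual_objective_le_Qval (R : realType) (P : program R) (t : nat)
    (psi : 'cV[R]_(sdim P t) -> R) (w : data P t)
    (x pi : 'cV[R]_(sdim P t.-1)) :
  (dual_objective psi w x pi <= Qval psi w x)%E.
Proof.
apply: le_ereal_inf_tmp => _ [p [zx Dp] <-].
rewrite /dual_objective -leeBrDr // -EFinB -zx.
by apply: ereal_inf_lbound; exists p.
Qed.

(** At [r] in the support the coefficient is [q - L] and a flip lowers the
    coordinate by 1; off the support both signs are reversed.  So each flipped
    coordinate contributes [q - L], and the sum counts the Hamming distance. *)
Lemma dot_cut_coef_sub (R : realType) (n : nat) (x z : 'cV[R]_n) (q L : R) :
  binary x -> binary z ->
  dot (cut_coef x q L) x - dot (cut_coef x q L) z =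
    (q - L) *+ #|[set r | x r 0 != z r 0]%SET|.
Proof.
move=> xb zb; rewrite -sumrB -sumr_const [RHS]big_mkcond /=.
apply: eq_bigr => r _; rewrite !inE mxE inE.
case: (xb r) => ->; case: (zb r) => ->;
  rewrite ?eqxx ?oner_eq0 1?eq_sym ?oner_eq0 /= ?mulr0 ?mulr1 ?subr0 ?sub0r
    ?subrr ?opprB //.
Qed.

(** The lower bound is used twice: at [x] it makes the penalty [q - L] per flip
    nonnegative, so that several flips cost no less than one, and at the other
    copies it bounds the unpenalized cost. *)
Lemma cut_coef_tight (R : realType) (P : program R) (t : nat)
    (psi : 'cV[R]_(sdim P t) -> R) (w : data P t)
    (x : 'cV[R]_(sdim P t.-1)) (q L : R) :
  binary x -> Qval psi w x = q%:E ->
  (forall z, binary z -> (L%:E <= Qval psi w z)%E) ->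
  (q%:E <= dual_objective psi w x (cut_coef x q L))%E.
Proof.
move=> xb Qx Llb.
have qL0 : 0 <= q - L by rewrite subr_ge0 -lee_fin -Qx; apply: Llb.
rewrite /dual_objective -leeBlDr // -EFinB.
apply: le_ereal_inf_tmp => _ [p Dp <-].
have [zb _] := Dp; have Qp := Qval_le_objective psi Dp.
rewrite lee_fin lerBlDr addrAC -addrA dot_cut_coef_sub //.
have [D0|[r Dr]] := set_0Vmem [set r | x r 0 != p.1.1 r 0]%SET.
  have zx : p.1.1 = x.
    apply/matrixP => r s; rewrite ord1; apply/esym/eqP/negbNE.
    by move/finset.setP: D0 => /(_ r); rewrite !inE => ->.
  by rewrite D0 cards0 mulr0n addr0 -lee_fin -Qx -{1}zx.
have Lp : L <= objective psi w p.
  by rewrite -lee_fin; apply: le_trans Qp; apply: Llb.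
rewrite -[q in q <= _](subrKC L) lerD //.
rewrite -[leLHS]mulr1n ler_wpMn2l //.
by apply/card_gt0P; exists r.
Qed.

Theorem proposition1 (R : realType) (P : program R)
  (psi : forall (i t : nat), 'cV[R]_(sdim P t) -> R)
  (psi_max_affine : forall i t, max_affine (psi i t))
  (xinc : forall (i k t : nat), 'cV[R]_(sdim P t))
  (i k t : nat) (ht : (2 <= t <= horizon P)%N) (j : 'I_(nreal P t))
  (xinc_binary : binary (xinc i k t.-1))
  (recourse : forall x : 'cV[R]_(sdim P t.-1), binary x ->
     feasible (omega j) x !=set0)
  (attained : forall x : 'cV[R]_(sdim P t.-1), binary x ->
     min_attained (feasible (omega j) x) (objective (psi i.+1 t) (omega j)))
  (L : R)
  (L_lower_bound : forall x : 'cV[R]_(sdim P t.-1), binary x ->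
     (L%:E <= Qval (psi i.+1 t) (omega j) x)%E) :
  optimal_max
    (dual_objective (psi i.+1 t) (omega j) (xinc i k t.-1))
    (cut_coef (xinc i k t.-1)
       (fine (Qval (psi i.+1 t) (omega j) (xinc i k t.-1))) L).
Proof.
have [p _ pE] := attained _ xinc_binary.
set x := xinc i k t.-1 in xinc_binary pE *.
have Qx : Qval (psi i.+1 t) (omega j) x =
    (objective (psi i.+1 t) (omega j) p)%:E by rewrite pE.
rewrite Qx /=; set pi := cut_coef _ _ _.
have dualE : dual_objective (psi i.+1 t) (omega j) x pi =
    Qval (psi i.+1 t) (omega j) x.
  apply/le_anti; rewrite dual_objective_le_Qval {1}Qx.
  exact: cut_coef_tight.
split=> [|pi']; rewrite dualE; first by rewrite Qx.
exact: dual_objective_le_Qval.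
Qed.
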